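(* Let $n,\lambda\ge 0$ be integers and let $\alpha,x,m,r$ be positive integers such that $\alpha\mid m$ and $\alpha\mid r$. Then $$D^{\lambda,x}_{m,r}(n+1;\alpha)=r\,D^{\lambda,x}_{m,r-\alpha}(n;\alpha)+x\lambda\,D^{\lambda,x}_{m,m+r-\alpha}(n;\alpha).$$
   Context: For integers $\alpha,m,x\ge 1$ and $r,\lambda\ge 0$, the higher order degenerate $r$-Dowling polynomials $D^{\lambda,x}_{m,r}(n;\alpha)$, $n\ge 0$, are defined by the formal power series identity $$\sum_{n=0}^{\infty}D^{\lambda,x}_{m,r}(n;\alpha)\frac{z^n}{n!}=e_\alpha^{r}(z)\,\exp\left(x\lambda\,\frac{e_\alpha^{m}(z)-1}{m}\right),\qquad e_\alpha^{s}(z)=(1+\alpha z)^{s/\alpha}.$$ *)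

(* Defs.v *)
From mathcomp Require Import all_boot all_order all_algebra.

Set Implicit Arguments.
Unset Strict Implicit.
Unset Printing Implicit Defensive.

Import Order.TTheory GRing.Theory Num.Theory.
Local Open Scope ring_scope.

(* A formal power series in z over the rationals, [f n] being the coefficient
   of z^n.  Equality of series is pointwise equality, [=1]. *)
Definition fps := nat -> rat.

Definition fps_one : fps := fun n => (n == 0%N)%:R.

Definition fps_sub (f g : fps) : fps := fun n => f n - g n.

Definition fps_scale (c : rat) (f : fps) : fps := fun n => c * f n.

Definition fps_mul (f g : fps) : fps :=
  fun n => \sum_(i < n.+1) f i * g (n - i)%N.

Definition fps_pow (f : fps) (k : nat) : fps := iter k (fps_mul f) fps_one.

(* exp(f) = \sum_k f^k / k!, meaningful only when [f 0 = 0].  In that case f^k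
   has no term of degree < k (lemma [fps_pow_small]), so that only the indices
   k <= n contribute to the coefficient of z^n. *)
Definition fps_exp (f : fps) : fps :=
  fun n => \sum_(k < n.+1) fps_pow f k n / (k`!)%:R.

(* The exponential generating function \sum_n a_n z^n / n!. *)
Definition fps_egf (a : nat -> rat) : fps := fun n => a n / (n`!)%:R.

(* a (a - 1) ... (a - n + 1) / n! *)
Definition gbinomial (a : rat) (n : nat) : rat :=
  (\prod_(i < n) (a - i%:R)) / (n`!)%:R.

(* The binomial series (1 + c z)^a = \sum_n gbinomial a n * c^n * z^n. *)
Definition fps_binomial (c a : rat) : fps :=
  fun n => gbinomial a n * c ^+ n.

(* e_alpha^s(z) = (1 + alpha z)^(s / alpha) *)
Definition degen_exp (alpha s : nat) : fps :=
  fps_binomial alpha%:R (s%:R / alpha%:R).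

(* e_alpha^r(z) * exp (x lambda (e_alpha^m(z) - 1) / m) *)
Definition rDowling_gf (m r lambda x alpha : nat) : fps :=
  fps_mul (degen_exp alpha r)
    (fps_exp (fps_scale ((x * lambda)%:R / m%:R)
                        (fps_sub (degen_exp alpha m) fps_one))).

(* [rDowling m r lambda x n alpha] is D^{lambda,x}_{m,r}(n; alpha). *)
Definition rDowling (m r lambda x n alpha : nat) : rat :=
  (n`!)%:R * rDowling_gf m r lambda x alpha n.

Lemma fps_pow_small (f : fps) (k n : nat) :
  f 0%N = 0 -> (n < k)%N -> fps_pow f k n = 0.
Proof.
move=> f0; elim: k n => [//|k IHk] n ltnk; rewrite /fps_pow iterS /fps_mul.
apply: big1 => -[[|i] /= lti] _; first by rewrite f0 mul0r.
by rewrite [iter _ _ _ _]IHk ?mulr0 // ltn_subLR // addSn (leq_trans ltnk) // ltnS leq_addl.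
Qed.

Lemma degen_exp0 (alpha s : nat) : degen_exp alpha s 0%N = 1.
Proof.
by rewrite /degen_exp /fps_binomial /gbinomial big_ord0 expr0 mulr1 divr1.
Qed.

Lemma rDowling_exponent0 (c : rat) (alpha m : nat) :
  fps_scale c (fps_sub (degen_exp alpha m) fps_one) 0%N = 0.
Proof. by rewrite /fps_scale /fps_sub degen_exp0 subrr mulr0. Qed.

(* [rDowling] is the unique sequence satisfying the generating function
   identity that defines the polynomials. *)
Lemma rDowling_egf (m r lambda x alpha : nat) (a : nat -> rat) :
  fps_egf a =1 rDowling_gf m r lambda x alpha <->
  a =1 fun n => rDowling m r lambda x n alpha.
Proof.
have nz n : (n`!)%:R != 0 :> rat by rewrite pnatr_eq0 -lt0n fact_gt0.
split=> [H n|H n]; first by rewrite /rDowling -H /fps_egf mulrC divfK.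
by rewrite /fps_egf H /rDowling mulrC mulKf.
Qed.

(* Main.v *)
Require Import Defs.
From mathcomp Require Import all_boot all_order all_algebra.

Import GRing.Theory Num.Theory.
Local Open Scope ring_scope.

(** The recurrence is the coefficientwise form of a derivative.  Put
    [P = 1 + alpha z], [m = a alpha], [r = b alpha] and
    [g = (x lambda / m) (P^a - 1)], so that the generating function is
    [P^b exp(g)].  Since [P' = alpha], one has [g' = x lambda P^(a-1)], and the
    Leibniz rule gives

      [(P^b exp(g))' = r P^(b-1) exp(g) + x lambda P^(a+b-1) exp(g)],

    whose two terms are the generating functions attached to [r - alpha] and
    [m + r - alpha].  Differentiating an exponential generating function shifts
    its sequence of coefficients, which is the claim.

    The divisibility hypotheses make [a] and [b] natural numbers, so [P^a] and
    [P^b] are polynomials ([degen_exp_coef]).  As [g] has no constant term, the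
    coefficient of [z^n] in [exp(g)] only sees the terms [g^k / k!] with
    [k <= n]; hence the whole computation takes place in the ring of
    polynomials, where [exp(g)] is replaced by a partial sum of its series that
    is long enough ([rDowling_coef]).  Differentiation shortens the partial sum
    by one term ([deriv_exp_psum]), and this is harmless because it also lowers
    by one the degree of the coefficient under consideration. *)

(** * Coefficients of power series given by polynomials *)

Lemma fps_mul_coef (f g : fps) (p q : {poly rat}) (n : nat) :
  (forall i, (i <= n)%N -> f i = p`_i) -> (forall i, (i <= n)%N -> g i = q`_i) ->
  fps_mul f g n = (p * q)`_n.
Proof.
move=> fp gq; rewrite coefM; apply: eq_bigr => i _.
by rewrite fp ?gq ?leq_subr // -ltnS.
Qed.

Lemma fps_pow_coef (f : fps) (p : {poly rat}) (k n : nat) :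
  (forall i, f i = p`_i) -> fps_pow f k n = (p ^+ k)`_n.
Proof.
move=> fp; elim: k n => [|k IHk] n; first by rewrite expr0 coef1.
by rewrite exprS -(@fps_mul_coef f (fps_pow f k)).
Qed.

Definition exp_psum (N : nat) (g : {poly rat}) : {poly rat} :=
  \sum_(k < N) (k`!)%:R^-1 *: g ^+ k.

(** The constant term of [g] vanishes, so [g^k] only contributes in degrees at
    least [k]: every partial sum with more than [n] terms has the same
    coefficient in degree [n]. *)
Lemma fps_exp_coef (f : fps) (g : {poly rat}) (N n : nat) :
  (forall i, f i = g`_i) -> f 0%N = 0 -> (n < N)%N ->
  fps_exp f n = (exp_psum N g)`_n.
Proof.
move=> fg f0 ltnN; rewrite /fps_exp coef_sum.
rewrite (big_ord_widen N (fun k => fps_pow f k n / (k`!)%:R) ltnN) big_mkcond.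
apply: eq_bigr => k _; rewrite coefZ -(fps_pow_coef f) // mulrC.
by case: ltnP => // ltnk; rewrite fps_pow_small ?mulr0.
Qed.

Lemma deriv_exp_psum (N : nat) (g : {poly rat}) :
  (exp_psum N.+1 g)^`() = g^`() * exp_psum N g.
Proof.
rewrite /exp_psum big_ord_recl expr0 derivD derivZ derivC scaler0 add0r.
rewrite raddf_sum mulr_sumr; apply: eq_bigr => k _.
rewrite /= derivZ deriv_exp -scalerAr -scaler_nat scalerA /= factS natrM.
by rewrite invfM mulrAC mulVf ?mul1r // pnatr_eq0.
Qed.

(** * Degenerate exponentials with integral exponent *)

(** Stated for all [n]: both sides vanish when [a < n], because the factor of
    index [a] on the left is zero. *)
Lemma prod_subr_ffact (a n : nat) :
  \prod_(i < n) (a%:R - i%:R) = (a ^_ n)%:R :> rat.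
Proof.
elim: n => [|n IHn]; first by rewrite big_ord0.
rewrite big_ord_recr /= IHn ffactnSr natrM.
by case: (leqP n a) => [/natrB-> //|/ffact_small->]; rewrite !mul0r.
Qed.

Lemma gbinomial_nat (a n : nat) : gbinomial a%:R n = 'C(a, n)%:R.
Proof.
rewrite /gbinomial prod_subr_ffact -bin_ffact natrM mulfK //.
by rewrite pnatr_eq0 -lt0n fact_gt0.
Qed.

Definition degen_base (alpha : nat) : {poly rat} := 1 + alpha%:R *: 'X.

Lemma deriv_degen_baseX (alpha a : nat) :
  (degen_base alpha ^+ a)^`() =
    (a * alpha)%:R *: degen_base alpha ^+ a.-1.
Proof.
rewrite deriv_exp derivD derivC add0r derivZ derivX -scalerAl mul1r.
by rewrite -scaler_nat scalerA natrM.
Qed.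

(** An exponent [s = a alpha] makes [(1 + alpha z)^(s / alpha)] the [a]-th power
    of a polynomial, by the binomial theorem. *)
Lemma degen_exp_coef (alpha a n : nat) : (0 < alpha)%N ->
  degen_exp alpha (a * alpha) n = (degen_base alpha ^+ a)`_n.
Proof.
move=> alpha_gt0; rewrite /degen_exp /fps_binomial natrM mulfK; last first.
  by rewrite (pnatr_eq0 rat) -lt0n.
rewrite gbinomial_nat /degen_base exprDn coef_sum.
under eq_bigr => i _ do
  rewrite expr1n mul1r exprZn coefMn coefZ coefXn.
have [lena|ltan] := leqP n a.
  rewrite (bigD1 (Ordinal (lena : n < a.+1)%N)) //= eqxx mulr1 big1 => [|i].
    by rewrite addr0 mulr_natl.
  by rewrite -val_eqE eq_sym /= => /negPf->; rewrite mulr0 mul0rn.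
rewrite bin_small // mul0r big1 // => i _.
by rewrite gtn_eqF ?mulr0 ?mul0rn // (leq_trans (ltn_ord i)).
Qed.

(** * The Dowling polynomials *)

Definition rDowling_exponent (alpha a : nat) (c : rat) : {poly rat} :=
  c *: (degen_base alpha ^+ a - 1).

Lemma rDowling_coef (alpha a b lambda x N n : nat) :
  (0 < alpha)%N -> (n < N)%N ->
  rDowling (a * alpha) (b * alpha) lambda x n alpha =
    (n`!)%:R * (degen_base alpha ^+ b * exp_psum N
      (rDowling_exponent alpha a ((x * lambda)%:R / (a * alpha)%:R)))`_n.
Proof.
move=> alpha_gt0 ltnN; congr (_ * _); apply: fps_mul_coef => i lein.
  exact: degen_exp_coef.
apply: fps_exp_coef => [j||]; last exact: leq_ltn_trans ltnN.
  by rewrite /fps_scale /fps_sub coefZ coefB coef1 degen_exp_coef.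
exact: rDowling_exponent0.
Qed.

Lemma deriv_rDowling_gf (alpha a b N : nat) (c : rat) :
  (0 < a)%N -> (0 < b)%N ->
  let g := rDowling_exponent alpha a c in
  (degen_base alpha ^+ b * exp_psum N.+1 g)^`() =
    (b * alpha)%:R *: (degen_base alpha ^+ b.-1 * exp_psum N.+1 g) +
    (c * (a * alpha)%:R) *: (degen_base alpha ^+ (a + b).-1 * exp_psum N g).
Proof.
move=> a_gt0 b_gt0 g; rewrite derivM deriv_exp_psum deriv_degen_baseX -scalerAl.
congr (_ + _); rewrite derivZ derivB derivC subr0 deriv_degen_baseX scalerA.
rewrite mulrA -scalerAr -scalerAl -exprD.
by rewrite (_ : b + a.-1 = (a + b).-1)%N // addnC -(prednK a_gt0).
Qed.

Theorem theorem4p3 (n lambda alpha x m r : nat)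
  (halpha : (0 < alpha)%N) (hx : (0 < x)%N) (hm : (0 < m)%N) (hr : (0 < r)%N)
  (dvd_m : (alpha %| m)%N) (dvd_r : (alpha %| r)%N) :
  rDowling m r lambda x n.+1 alpha =
    r%:R * rDowling m (r - alpha) lambda x n alpha
    + (x * lambda)%:R * rDowling m (m + r - alpha) lambda x n alpha.
Proof.
case/dvdnP: dvd_m hm => a ->; case/dvdnP: dvd_r hr => b -> {m r}.
rewrite !muln_gt0 halpha !andbT => b_gt0 a_gt0.
have predM k : (k * alpha - alpha = k.-1 * alpha)%N by rewrite -subn1 mulnBl mul1n.
rewrite -mulnDl !predM.
(* One more term in the partial sum than in the last summand, since
   differentiation removes one. *)
rewrite (@rDowling_coef _ _ _ _ _ n.+2) // (@rDowling_coef _ _ b.-1 _ _ n.+2) //.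
rewrite (@rDowling_coef _ _ (a + b).-1 _ _ n.+1) //.
rewrite factS natrM -mulrA mulrCA [n.+1%:R * _]mulr_natl -coef_deriv deriv_rDowling_gf //.
rewrite divfK; last by rewrite pnatr_eq0 -lt0n muln_gt0 a_gt0.
by rewrite coefD !coefZ mulrDr; congr (_ + _); rewrite mulrCA.
Qed.
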